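(* Let $\triangle PQR$ be a (closed, filled) triangle in $D$ with $d'(P,R)=d'(Q,R)$, $d'(P,Q)>\log 3$ and $\delta(P,Q,R)<\Delta_2'(P,Q)$. Then $\rho(\psi_{\triangle PQR})>\frac{2}{5}$.
   Context: $D$ is the open unit disk in $\mathbb R^2$, $S^1$ its boundary circle identified with $\mathbb R/\mathbb Z$ via the counterclockwise normalized angle. For a closed convex $U\subset D$ and $v\in S^1$, $\psi_U(v)$ is the point $w\in S^1\setminus\{v\}$ such that the line $vw$ meets $U$ and $U$ lies in the closed half-plane to the left of the directed line from $v$ to $w$; it is an orientation-preserving homeomorphism of $S^1$. For such $f$, $\rho(f)=\lim_{n\to\infty}(\overline f^n(x)-x)/n$ with $\overline f$ the lift to $\mathbb R$ satisfying $\overline f(0)\in[0,1)$. Regard $D$ as the Beltrami–Klein model (hyperbolic lines are chords). For distinct $P,Q\in D$ with chord endpoints $v_1,v_2\in S^1$, $d'(P,Q)=\tfrac12\left|\log\frac{|v_1Q||v_2P|}{|v_1P||v_2Q|}\right|$; $\Delta_n'(P,Q)=\log\frac{e^{n d'(P,Q)}+1}{e^{n d'(P,Q)}-1}$ for $n\in\mathbb Z_{>0}$; $\delta(P,Q,R)=\min\{d'(R,S): S \text{ on the chord through } P,Q\}$. *)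

(* Defs.v *)
From Stdlib Require Import Reals.
From Coquelicot Require Import Coquelicot.
Open Scope R_scope.

Definition pt := (R * R)%type.

Definition padd (A B : pt) : pt := (fst A + fst B, snd A + snd B).
Definition psub (A B : pt) : pt := (fst A - fst B, snd A - snd B).
Definition pscal (t : R) (A : pt) : pt := (t * fst A, t * snd A).
Definition dot (A B : pt) : R := fst A * fst B + snd A * snd B.
(* cross (B - A) (X - A) > 0 iff X is strictly to the left of the directed line A -> B *)
Definition cross (A B : pt) : R := fst A * snd B - snd A * fst B.
Definition pdist (A B : pt) : R := sqrt (dot (psub A B) (psub A B)).

Definition inD (P : pt) : Prop := dot P P < 1.

Definition ecirc (x : R) : pt := (cos (2 * PI * x), sin (2 * PI * x)).
Definition onS1 (v : pt) : Prop := dot v v = 1.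

(* psi_rel U v w : w = psi_U(v), i.e. w in S^1 \ {v}, the line vw meets U,
   and U lies in the closed half-plane to the left of the directed line v -> w. *)
Definition psi_rel (U : pt -> Prop) (v w : pt) : Prop :=
  onS1 w /\ w <> v /\
  (exists x, U x /\ cross (psub w v) (psub x v) = 0) /\
  (forall x, U x -> 0 <= cross (psub w v) (psub x v)).

Definition is_normalized_lift_psi (U : pt -> Prop) (F : R -> R) : Prop :=
  continuity F /\ 0 <= F 0 < 1 /\
  forall x, psi_rel U (ecirc x) (ecirc (F x)).

Definition rotation_number_is (F : R -> R) (L : R) : Prop :=
  forall x, Un_cv (fun n => (Nat.iter n F x - x) / INR n) L.

Definition filled_triangle (P Q R0 : pt) : pt -> Prop :=
  fun X => exists a b c, 0 <= a /\ 0 <= b /\ 0 <= c /\ a + b + c = 1 /\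
    X = padd (pscal a P) (padd (pscal b Q) (pscal c R0)).

(* Endpoints on S^1 of the chord through P and Q (P <> Q, both in D):
   P + t (Q - P) with |.|^2 = 1, i.e. a t^2 + 2 b t + c = 0. *)
Definition chord_end (P Q : pt) (s : R) : pt :=
  let a := dot (psub Q P) (psub Q P) in
  let b := dot P (psub Q P) in
  let c := dot P P - 1 in
  padd P (pscal ((- b + s * sqrt (b * b - a * c)) / a) (psub Q P)).

(* Hilbert (Klein-model) distance d'(P,Q); set to 0 when P = Q. *)
Definition dK (P Q : pt) : R :=
  if Req_EM_T (fst P) (fst Q) then
    (if Req_EM_T (snd P) (snd Q) then 0 else
     let v1 := chord_end P Q 1 in let v2 := chord_end P Q (-1) in
     / 2 * Rabs (ln ((pdist v1 Q * pdist v2 P) / (pdist v1 P * pdist v2 Q))))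
  else
     let v1 := chord_end P Q 1 in let v2 := chord_end P Q (-1) in
     / 2 * Rabs (ln ((pdist v1 Q * pdist v2 P) / (pdist v1 P * pdist v2 Q))).

Definition DeltaK (n : nat) (P Q : pt) : R :=
  ln ((exp (INR n * dK P Q) + 1) / (exp (INR n * dK P Q) - 1)).

Definition on_chord (P Q S : pt) : Prop :=
  inD S /\ exists t, S = padd P (pscal t (psub Q P)).

Definition deltaK (P Q R0 : pt) : Rbar :=
  Glb_Rbar (fun r => exists S, on_chord P Q S /\ r = dK R0 S).

(* Main.v *)
Require Import Defs.
From Stdlib Require Import Reals ZArith Nsatz Lra Lia List.
From Coquelicot Require Import Coquelicot.
Open Scope R_scope.

(** For [V] in the disk let [hturn V] be the lift of the involution of the circle
    that exchanges the endpoints of every chord through [V]. The lift [F] of the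
    theorem is the pointwise minimum of [hturn P], [hturn Q] and [hturn R0], so
    each [F^5 x] is the value at [x] of a word of length 5 in these three maps,
    and it suffices that every such word moves every point by more than 2.

    That property is invariant under cyclic rotation of the word, and two equal
    neighbours compose to the translation by 1, so what remains are the words
    [U V W] and [W U V U V] with distinct letters. The maps [hturn U] and [hturn V]
    agree at an endpoint of the chord [UV], hence the word moves that point by
    more than the required integer. By continuity a failure elsewhere would give
    a fixed point on the circle. But [hturn V] acts projectively on the circle by
    a trace-zero 2x2 matrix, and a real eigenvector of the word is excluded when
    [tr^2 < 4 det]. For [W U V U V] this reads [2 N cosh d(U,V) < 1] with
    [N = sinh d(U,V) sinh delta(U,V,W)], which is symmetric in [U], [V], [W].
    For [U V = P Q] it is the hypothesis on [delta]; for the other two sides it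
    follows because [d(P,Q) > ln 3] forces [d(P,R0) = d(Q,R0) <= d(P,Q)]. *)

(** * Point reflections on the boundary circle *)

Lemma dot_lt_1 (U V : pt) : dot U U <= 1 -> inD V -> dot U V < 1.
Proof.
unfold inD, dot; destruct U as [a b], V as [p q]; simpl; intros.
generalize (Rle_0_sqr (a - p)) (Rle_0_sqr (b - q)); unfold Rsqr; lra.
Qed.

(* Half the angle of [ecirc x]: on these vectors chord involutions act linearly. *)
Definition uvec (x : R) : pt := (cos (PI * x), sin (PI * x)).

(* The symmetric bilinear form of [uvec x] and [uvec y] that vanishes iff [V] lies
   on the chord from [ecirc x] to [ecirc y], see [cross_ecirc]. *)
Definition chord_form (V : pt) (x y : R) : R :=
  dot (uvec x) (uvec y)
  - fst V * (cos (PI * x) * cos (PI * y) - sin (PI * x) * sin (PI * y))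
  - snd V * (sin (PI * x) * cos (PI * y) + cos (PI * x) * sin (PI * y)).

(* The inscribed angle at [ecirc x] from the diameter to the chord through [V] is half
   the central angle between the antipode of [ecirc x] and the second endpoint. *)
Definition hturn (V : pt) (x : R) : R :=
  x + / 2 + atan (- cross (ecirc x) V / (1 - dot (ecirc x) V)) / PI.

Lemma ecirc_double (x : R) :
  ecirc x = (cos (PI * x) * cos (PI * x) - sin (PI * x) * sin (PI * x),
             2 * (sin (PI * x) * cos (PI * x))).
Proof.
unfold ecirc; replace (2 * PI * x) with (2 * (PI * x)) by ring.
rewrite cos_2a, sin_2a; f_equal; ring.
Qed.

Lemma uvec_norm (x : R) :
  cos (PI * x) * cos (PI * x) + sin (PI * x) * sin (PI * x) = 1.
Proof. generalize (sin2_cos2 (PI * x)); unfold Rsqr; lra. Qed.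

Lemma ecirc_dot_lt_1 (V : pt) (x : R) : inD V -> dot (ecirc x) V < 1.
Proof.
intros HV; apply dot_lt_1; auto.
unfold ecirc, dot; simpl; generalize (sin2_cos2 (2 * PI * x)); unfold Rsqr; lra.
Qed.

Lemma cross_ecirc (V : pt) (x y : R) :
  cross (psub (ecirc y) (ecirc x)) (psub V (ecirc x)) =
  2 * sin (PI * (y - x)) * chord_form V x y.
Proof.
replace (PI * (y - x)) with (PI * y - PI * x) by ring.
rewrite sin_minus, !ecirc_double.
unfold cross, psub, chord_form, dot, uvec; destruct V as [p q]; simpl.
generalize (uvec_norm x) (uvec_norm y).
generalize (cos (PI * x)) (sin (PI * x)) (cos (PI * y)) (sin (PI * y)).
intros a b c d Hx Hy.
nsatz.
Qed.

(** For fixed [x] the form is linear in [uvec y], hence a sinusoid in [PI * y], and [hturn V x] is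
    its zero. The amplitude is positive because [V] is inside the disk, so the sign of the form
    tells on which side of [hturn V x] a nearby [y] lies. *)
Lemma chord_form_hturn (V : pt) (x : R) :
  inD V ->
  exists k, 0 < k /\ forall y, chord_form V x y = k * sin (PI * (hturn V x - y)).
Proof.
intros HV.
generalize (ecirc_dot_lt_1 V x HV); intros H1.
set (n := - cross (ecirc x) V); set (d := 1 - dot (ecirc x) V).
set (th := atan (n / d)).
assert (Hd : 0 < d) by (unfold d; lra).
assert (Hth : - PI / 2 < th < PI / 2) by apply atan_bound.
assert (Hc : 0 < cos th) by (apply cos_gt_0; lra).
assert (Ht : sin th / cos th = n / d) by (apply (tan_atan (n / d))).
assert (Ht' : sin th = n / d * cos th) by (rewrite <- Ht; field; lra).
exists (d / cos th); split; [apply Rdiv_lt_0_compat; lra|].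
intros y.
generalize PI_RGT_0; intros HPI.
replace (PI * (hturn V x - y)) with (PI / 2 + (th - (PI * y - PI * x))).
2:{ unfold hturn; fold n d; fold th; field; lra. }
rewrite sin_plus, sin_PI2, cos_PI2, cos_minus, cos_minus, sin_minus, Ht'.
transitivity (d * (cos (PI * y) * cos (PI * x) + sin (PI * y) * sin (PI * x))
  + n * (sin (PI * y) * cos (PI * x) - cos (PI * y) * sin (PI * x))).
2:{ field; lra. }
unfold n, d; rewrite ecirc_double.
unfold cross, chord_form, dot, uvec; destruct V as [p q]; simpl.
generalize (uvec_norm x).
generalize (cos (PI * x)) (sin (PI * x)) (cos (PI * y)) (sin (PI * y)).
intros a b c e Hx; nsatz.
Qed.

Lemma hturn_bounds (V : pt) (x : R) : x < hturn V x < x + 1.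
Proof.
unfold hturn; set (z := atan _).
assert (Hz : - PI / 2 < z < PI / 2) by apply atan_bound.
generalize PI_RGT_0; intros HPI.
assert (Hq : - / 2 < z / PI < / 2).
{ split; apply (Rmult_lt_reg_r PI); auto; unfold Rdiv at 1;
  try rewrite Rmult_assoc, Rinv_l by lra; lra. }
lra.
Qed.

Lemma ecirc_add1 (x : R) : ecirc (x + 1) = ecirc x.
Proof.
unfold ecirc; replace (2 * PI * (x + 1)) with (2 * PI * x + 2 * PI) by ring.
now rewrite cos_plus, sin_plus, cos_2PI, sin_2PI, !Rmult_0_r, !Rmult_1_r,
  Rminus_0_r, Rplus_0_r.
Qed.

Lemma hturn_add1 (V : pt) (x : R) : hturn V (x + 1) = hturn V x + 1.
Proof. unfold hturn; rewrite ecirc_add1; ring. Qed.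

Lemma sin_PI_pos (t : R) : 0 < t < 1 -> 0 < sin (PI * t).
Proof. generalize PI_RGT_0; intros; apply sin_gt_0; nra. Qed.

Lemma sin_PI_neg (t : R) : - 1 < t < 0 -> sin (PI * t) < 0.
Proof.
intros; replace (PI * t) with (- (PI * - t)) by ring; rewrite sin_neg.
enough (0 < sin (PI * - t)) by lra; apply sin_PI_pos; lra.
Qed.

Lemma chord_form_sym (V : pt) (x y : R) : chord_form V x y = chord_form V y x.
Proof. unfold chord_form, dot; simpl; ring. Qed.

Lemma uvec_add1 (x : R) : uvec (x + 1) = pscal (-1) (uvec x).
Proof.
unfold uvec, pscal; replace (PI * (x + 1)) with (PI * x + PI) by ring.
rewrite neg_cos, neg_sin; simpl; f_equal; ring.
Qed.

Lemma chord_form_add1 (V : pt) (x y : R) :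
  chord_form V x (y + 1) = - chord_form V x y.
Proof.
generalize (uvec_add1 y); unfold uvec, pscal; simpl; intros E; injection E; intros E1 E2.
unfold chord_form, dot, uvec; simpl; rewrite E1, E2; ring.
Qed.

Lemma chord_form_eq_0 (V : pt) (x y : R) :
  inD V -> x < y < x + 1 -> chord_form V x y = 0 -> y = hturn V x.
Proof.
intros HV Hy E; destruct (chord_form_hturn V x HV) as (k & Hk & Ek).
generalize (hturn_bounds V x); intros Hh; rewrite Ek in E.
destruct (Rtotal_order y (hturn V x)) as [H|[H|H]]; auto.
- generalize (sin_PI_pos (hturn V x - y)); intros; nra.
- generalize (sin_PI_neg (hturn V x - y)); intros; nra.
Qed.

Lemma chord_form_ge_0 (V : pt) (x y : R) :
  inD V -> x < y < x + 1 -> 0 <= chord_form V x y -> y <= hturn V x.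
Proof.
intros HV Hy E; destruct (chord_form_hturn V x HV) as (k & Hk & Ek).
generalize (hturn_bounds V x); intros Hh; rewrite Ek in E.
destruct (Rle_or_lt y (hturn V x)) as [H|H]; auto.
generalize (sin_PI_neg (hturn V x - y)); intros; nra.
Qed.

Lemma chord_form_hturn_0 (V : pt) (x : R) :
  inD V -> chord_form V x (hturn V x) = 0.
Proof.
intros HV; destruct (chord_form_hturn V x HV) as (k & Hk & Ek).
rewrite Ek, Rminus_diag, Rmult_0_r, sin_0; ring.
Qed.

Lemma hturn_hturn (V : pt) (x : R) : inD V -> hturn V (hturn V x) = x + 1.
Proof.
intros HV; symmetry; generalize (hturn_bounds V x); intros Hh.
apply chord_form_eq_0; auto; try lra.
rewrite chord_form_add1, chord_form_sym, chord_form_hturn_0; auto; ring.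
Qed.

(** If [y < hturn V x], the form at [y] and [hturn V x] is positive: based at [hturn V x], its zero
    is [x + 1], which lies beyond [y]. Based at [y], positivity puts [hturn V x] before
    [hturn V y]. *)
Lemma hturn_incr (V : pt) (x y : R) : inD V -> x < y -> hturn V x < hturn V y.
Proof.
intros HV Hxy; generalize (hturn_bounds V x) (hturn_bounds V y); intros Hx Hy.
destruct (Rle_or_lt (hturn V x) y) as [H|H]; [lra|].
assert (Hp : 0 < chord_form V y (hturn V x)).
{ rewrite chord_form_sym.
  destruct (chord_form_hturn V (hturn V x) HV) as (k & Hk & Ek).
  rewrite Ek, hturn_hturn; auto; apply Rmult_lt_0_compat; auto.
  apply sin_PI_pos; lra. }
destruct (Rle_or_lt (hturn V y) (hturn V x)) as [H'|H']; auto.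
destruct (chord_form_hturn V y HV) as (k & Hk & Ek); rewrite Ek in Hp.
destruct H' as [H'|H'].
- generalize (sin_PI_neg (hturn V y - hturn V x)); intros; nra.
- rewrite H', Rminus_diag, Rmult_0_r, sin_0 in Hp; lra.
Qed.

Lemma hturn_continuity (V : pt) : inD V -> continuity (hturn V).
Proof.
intros HV x; apply continuity_pt_filterlim.
apply (ex_derive_continuous (hturn V) x).
unfold hturn, ecirc, cross, dot; simpl.
auto_derive.
generalize (ecirc_dot_lt_1 V x HV); unfold ecirc, dot; simpl; lra.
Qed.

(** Since both maps are increasing and square to the translation by 1, their difference changes sign
    between 0 and [hturn U 0]. *)
Lemma hturn_agree (U V : pt) :
  inD U -> inD V -> exists z, hturn U z = hturn V z.
Proof.
intros HU HV.
destruct (IVT_cor (fun x => hturn U x - hturn V x) 0 (hturn U 0)) as (z & _ & Hz).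
- apply continuity_minus; apply hturn_continuity; auto.
- generalize (hturn_bounds U 0); lra.
- rewrite (hturn_hturn U 0 HU).
  generalize (hturn_hturn V 0 HV); intros E.
  destruct (Rtotal_order (hturn U 0) (hturn V 0)) as [H|[H|H]].
  + generalize (hturn_incr V _ _ HV H); nra.
  + rewrite H; lra.
  + generalize (hturn_incr V _ _ HV H); nra.
- exists z; lra.
Qed.

(** * The Klein distance *)

(* [cosh (dK P Q) = kform P Q / sqrt (kgap P * kgap Q)], see [dK_exp]. *)
Definition kgap (P : pt) : R := 1 - dot P P.
Definition kform (P Q : pt) : R := 1 - dot P Q.

(** Divided by the four gaps, the left side is [sinh^2 d(R0,S) sinh^2 d(P,Q)]. The right side is a
    term independent of [S] plus a square, which bounds the distance from [R0] to the line below. *)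
Lemma cross_line (P Q R0 : pt) (t : R) :
  let S := padd P (pscal t (psub Q P)) in
  (kform R0 S * kform R0 S - kgap R0 * kgap S)
    * (kform P Q * kform P Q - kgap P * kgap Q)
  = kgap S * (cross (psub Q P) (psub R0 P) * cross (psub Q P) (psub R0 P))
    + (kform S Q * kform R0 P - kform S P * kform R0 Q)
      * (kform S Q * kform R0 P - kform S P * kform R0 Q).
Proof. unfold kform, kgap, dot, psub, padd, pscal, cross; simpl; ring. Qed.

(** The right side is the Gram determinant of [(1, P)], [(1, Q)], [(1, R0)] for the Lorentz form of
    signature (1,2); the left side is the square of their determinant. *)
Lemma cross_gram (P Q R0 : pt) :
  cross (psub Q P) (psub R0 P) * cross (psub Q P) (psub R0 P) =
  kgap P * kgap Q * kgap R0 + 2 * kform P Q * kform P R0 * kform Q R0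
  - kgap P * (kform Q R0 * kform Q R0) - kgap Q * (kform P R0 * kform P R0)
  - kgap R0 * (kform P Q * kform P Q).
Proof. unfold kform, kgap, dot, psub, cross; simpl; ring. Qed.

Lemma pdist_ray (P V : pt) (s t : R) :
  pdist (padd P (pscal s V)) (padd P (pscal t V)) = Rabs (s - t) * sqrt (dot V V).
Proof.
unfold pdist; rewrite <- sqrt_Rsqr_abs, <- sqrt_mult_alt by apply Rle_0_sqr.
f_equal; unfold dot, psub, padd, pscal, Rsqr; simpl; ring.
Qed.

(** The absolute value only decides whether [e * e] is [rho] or [/ rho], and [(e + / e)^2] is the
    same for both. *)
Lemma exp_half_Rabs_ln (rho : R) :
  0 < rho ->
  let e := exp (/ 2 * Rabs (ln rho)) in
  1 <= e /\ (e + / e) * (e + / e) * rho = (rho + 1) * (rho + 1).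
Proof.
intros Hr e.
assert (He : 0 < e) by apply exp_pos.
assert (H2 : e * e = rho \/ e * e = / rho).
{ unfold e; rewrite <- exp_plus.
  replace (/ 2 * Rabs (ln rho) + / 2 * Rabs (ln rho)) with (Rabs (ln rho)) by field.
  destruct (Rcase_abs (ln rho)) as [H|H].
  - right; rewrite Rabs_left, exp_Ropp, exp_ln; auto.
  - left; rewrite Rabs_right, exp_ln; auto. }
split.
- rewrite <- exp_0; unfold e.
  assert (H0 : 0 <= / 2 * Rabs (ln rho)) by (generalize (Rabs_pos (ln rho)); lra).
  destruct H0 as [H0|H0]; [left; apply exp_increasing; lra|rewrite <- H0; lra].
- replace ((e + / e) * (e + / e)) with (e * e + 2 + / (e * e)) by (field; lra).
  destruct H2 as [H2|H2]; rewrite H2; field; lra.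
Qed.

Lemma dK_exp (P Q : pt) :
  inD P -> inD Q ->
  let e := exp (dK P Q) in
  1 <= e /\
  (e + / e) * (e + / e) * (kgap P * kgap Q) = 4 * (kform P Q * kform P Q).
Proof.
intros HP HQ.
(* For coinciding points the chord is undefined and [dK] takes its default value 0, which also
   satisfies the formula. *)
assert (Hsame : P = Q -> dK P Q = 0).
{ intros <-; unfold dK; destruct (Req_EM_T _ _); try easy; destruct (Req_EM_T _ _); easy. }
destruct (Req_dec (dot (psub Q P) (psub Q P)) 0) as [H0|H0].
{ assert (E : P = Q).
  { destruct P as [p1 p2], Q as [q1 q2]; unfold dot, psub in H0; simpl in H0.
    destruct (Rplus_sqr_eq_0 (q1 - p1) (q2 - p2) H0); f_equal; lra. }
  rewrite (Hsame E), exp_0, <- E; simpl; split; [lra|].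
  unfold kgap, kform; field. }
assert (Ha : 0 < dot (psub Q P) (psub Q P)).
{ assert (0 <= dot (psub Q P) (psub Q P)) by (unfold dot; nra); lra. }
set (a := dot (psub Q P) (psub Q P)) in *.
set (b := dot P (psub Q P)).
set (c := dot P P - 1).
assert (Hc : c < 0) by (unfold c, inD in *; lra).
assert (Hs' : a + 2 * b + c = - kgap Q).
{ unfold a, b, c, kgap, dot, psub; simpl; ring. }
assert (HgQ : 0 < kgap Q) by (unfold kgap, inD in *; lra).
assert (HgP : kgap P = - c) by (unfold kgap, c; ring).
assert (HB : kform P Q = - (b + c)).
{ unfold kform, b, c, dot, psub; simpl; ring. }
assert (Hdisc : 0 < b * b - a * c) by nra.
set (w := sqrt (b * b - a * c)).
assert (Hw : 0 < w) by (apply sqrt_lt_R0; auto).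
assert (Hww : w * w = b * b - a * c) by (apply sqrt_sqrt; lra).
set (t1 := (- b + 1 * w) / a); set (t2 := (- b + -1 * w) / a).
assert (E1 : chord_end P Q 1 = padd P (pscal t1 (psub Q P))) by reflexivity.
assert (E2 : chord_end P Q (-1) = padd P (pscal t2 (psub Q P))) by reflexivity.
assert (A1 : a * t1 = - b + w) by (unfold t1; field; lra).
assert (A2 : a * t2 = - b - w) by (unfold t2; field; lra).
(* The quadratic [a t^2 + 2 b t + c] is negative at 0 and at 1, the parameters of [P] and [Q], so
   both lie strictly between its roots. *)
assert (Ht1 : 1 < t1).
{ apply (Rmult_lt_reg_l a); auto; rewrite A1.
  enough (a + b < w) by lra.
  destruct (Rle_or_lt (a + b) 0); [lra|]; nra. }
assert (Ht2 : t2 < 0).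
{ apply (Rmult_lt_reg_l a); auto; rewrite A2.
  enough (- b < w) by lra.
  destruct (Rle_or_lt (- b) 0); [lra|]; nra. }
assert (Sum : t1 + t2 = - 2 * b / a) by (unfold t1, t2; field; lra).
assert (Prod : t1 * t2 = c / a).
{ apply (Rmult_eq_reg_l (a * a)); [|nra].
  replace (a * a * (t1 * t2)) with ((a * t1) * (a * t2)) by ring.
  rewrite A1, A2; replace (a * a * (c / a)) with (a * c) by (field; lra); nra. }
assert (Psame : P = padd P (pscal 0 (psub Q P))).
{ destruct P; unfold padd, pscal; simpl; f_equal; ring. }
assert (Qsame : Q = padd P (pscal 1 (psub Q P))).
{ destruct P, Q; unfold padd, pscal; simpl; f_equal; ring. }
set (rho := (t1 - 1) * (- t2) / (t1 * (1 - t2))).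
assert (Hrho : 0 < rho).
{ unfold rho; apply Rdiv_lt_0_compat; apply Rmult_lt_0_compat; lra. }
assert (Hratio : (pdist (chord_end P Q 1) Q * pdist (chord_end P Q (-1)) P) /
  (pdist (chord_end P Q 1) P * pdist (chord_end P Q (-1)) Q) = rho).
{ rewrite E1, E2.
  assert (D1 : forall t, pdist (padd P (pscal t (psub Q P))) Q = Rabs (t - 1) * sqrt a).
  { intros t; unfold a; rewrite <- (pdist_ray P), <- Qsame; reflexivity. }
  assert (D0 : forall t, pdist (padd P (pscal t (psub Q P))) P = Rabs (t - 0) * sqrt a).
  { intros t; unfold a; rewrite <- (pdist_ray P), <- Psame; reflexivity. }
  rewrite !D0, !D1.
  rewrite (Rabs_right (t1 - 1)), (Rabs_right (t1 - 0)), (Rabs_left (t2 - 0)),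
    (Rabs_left (t2 - 1)) by lra.
  assert (0 < sqrt a) by (apply sqrt_lt_R0; auto).
  unfold rho; field; repeat split; lra. }
assert (HdK : dK P Q = / 2 * Rabs (ln rho)).
{ unfold dK; cbv zeta; rewrite Hratio.
  destruct (Req_EM_T (fst P) (fst Q)) as [F1|F1]; auto.
  destruct (Req_EM_T (snd P) (snd Q)) as [F2|F2]; auto.
  exfalso; unfold a, dot, psub in Ha; simpl in Ha; rewrite F1, F2 in Ha; lra. }
rewrite HdK; cbv zeta.
destruct (exp_half_Rabs_ln rho Hrho) as [He1 He2]; cbv zeta in He2; split; auto.
set (m := (_ + _) * (_ + _)) in *.
(* Vieta: in terms of [t1 + t2] and [t1 t2] both sides are symmetric functions. *)
assert (N1 : (t1 - 1) * (1 - t2) = kgap Q / a).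
{ replace (kgap Q) with (- (a + 2 * b + c)) by lra.
  replace ((t1 - 1) * (1 - t2)) with ((t1 + t2) - t1 * t2 - 1) by ring.
  rewrite Sum, Prod; field; lra. }
assert (N2 : t1 * - t2 = kgap P / a).
{ rewrite HgP; replace (t1 * - t2) with (- (t1 * t2)) by ring; rewrite Prod; field; lra. }
assert (N3 : t1 * (1 - t2) + (t1 - 1) * - t2 = 2 * kform P Q / a).
{ rewrite HB; replace (t1 * (1 - t2) + (t1 - 1) * - t2) with ((t1 + t2) - 2 * (t1 * t2)) by ring.
  rewrite Sum, Prod; field; lra. }
set (y := t1 * (1 - t2)) in *; set (z := (t1 - 1) * - t2) in *.
assert (Hy : 0 < y) by (apply Rmult_lt_0_compat; lra).
assert (Hm : m * (z * y) = (y + z) * (y + z)).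
{ replace (m * (z * y)) with (m * rho * (y * y)) by (unfold rho; field; lra).
  rewrite He2; unfold rho; field; lra. }
assert (Hzy : z * y = kgap P * kgap Q / (a * a)).
{ transitivity ((kgap Q / a) * (kgap P / a)); [|field; lra].
  rewrite <- N1, <- N2; unfold z, y; ring. }
rewrite Hzy, N3 in Hm.
apply (Rmult_eq_reg_r (/ (a * a))).
2:{ apply Rinv_neq_0_compat; nra. }
transitivity (m * (kgap P * kgap Q / (a * a))); [field; lra|].
rewrite Hm; field; lra.
Qed.

(** * Rotation numbers *)

Section Rotation.

Variable F : R -> R.
Hypothesis F_mono : forall x y, x <= y -> F x <= F y.
Hypothesis F_add1 : forall x, F (x + 1) = F x + 1.

Lemma iter_mono n x y : x <= y -> Nat.iter n F x <= Nat.iter n F y.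
Proof. induction n; simpl; auto. Qed.

Lemma iter_add1 n x : Nat.iter n F (x + 1) = Nat.iter n F x + 1.
Proof. induction n; simpl; auto; rewrite IHn; auto. Qed.

Lemma iter_add_IZR n x z : Nat.iter n F (x + IZR z) = Nat.iter n F x + IZR z.
Proof.
assert (HN : forall m y, Nat.iter n F (y + INR m) = Nat.iter n F y + INR m).
{ induction m; intros y; [now rewrite !Rplus_0_r|].
  rewrite S_INR, <- Rplus_assoc, iter_add1, IHm; ring. }
destruct (Z.lt_ge_cases z 0) as [H|H].
- assert (E : IZR z = - INR (Z.to_nat (- z))).
  { rewrite INR_IZR_INZ, Z2Nat.id, opp_IZR by lia; ring. }
  generalize (HN (Z.to_nat (- z)) (x + IZR z)); rewrite E.
  replace (x + - INR (Z.to_nat (- z)) + INR (Z.to_nat (- z))) with x by ring; lra.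
- assert (E : IZR z = INR (Z.to_nat z)) by (rewrite INR_IZR_INZ, Z2Nat.id by lia; easy).
  rewrite E; apply HN.
Qed.

(** Some integer translate of [y] lies between [x] and [x + 1]; monotonicity then traps its iterate
    between those of [x] and [x + 1]. *)
Lemma iter_displacement n x y :
  Rabs ((Nat.iter n F x - x) - (Nat.iter n F y - y)) <= 1.
Proof.
destruct (archimed (x - y)) as [H1 H2].
set (z := up (x - y)) in *.
generalize (iter_add_IZR n y z); intros E.
assert (A1 : Nat.iter n F x <= Nat.iter n F (y + IZR z)) by (apply iter_mono; lra).
assert (A2 : Nat.iter n F (y + IZR z) <= Nat.iter n F (x + 1)) by (apply iter_mono; lra).
rewrite iter_add1 in A2; rewrite E in A1, A2.
apply Rabs_le; lra.
Qed.

Lemma iter_mul_displacement m n x :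
  Rabs ((Nat.iter (n * m) F x - x) - INR n * (Nat.iter m F x - x)) <= INR n.
Proof.
induction n.
- simpl; rewrite Rmult_0_l, Rminus_diag, Rminus_0_r, Rabs_R0; lra.
- rewrite S_INR; simpl (S n * m)%nat; rewrite Nat.iter_add.
  set (y := Nat.iter (n * m) F x) in *.
  generalize (iter_displacement m y x); intros H.
  apply Rabs_le; apply Rabs_le_between in H; apply Rabs_le_between in IHn; lra.
Qed.

(** Both means are compared with the one for the product of the two iteration counts. *)
Lemma iter_mean_dist m n x :
  Rabs ((Nat.iter (S m) F x - x) / INR (S m) - (Nat.iter (S n) F x - x) / INR (S n))
  <= / INR (S m) + / INR (S n).
Proof.
generalize (iter_mul_displacement (S m) (S n) x) (iter_mul_displacement (S n) (S m) x).
rewrite (Nat.mul_comm (S m) (S n)).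
assert (Hm : 0 < INR (S m)) by (apply lt_0_INR; lia).
assert (Hn : 0 < INR (S n)) by (apply lt_0_INR; lia).
generalize dependent (INR (S m)); intros M HM.
generalize dependent (INR (S n)); intros N HN H1 H2.
generalize dependent (Nat.iter (S n * S m) F x - x); intros Z.
generalize (Nat.iter (S m) F x - x) (Nat.iter (S n) F x - x); intros X Y H1 H2.
assert (HMN : 0 < M * N) by (apply Rmult_lt_0_compat; auto).
replace (X / M - Y / N) with ((N * X - M * Y) / (M * N)) by (field; lra).
replace (/ M + / N) with ((M + N) / (M * N)) by (field; lra).
unfold Rdiv; rewrite Rabs_mult, (Rabs_right (/ (M * N))).
2:{ apply Rle_ge; left; apply Rinv_0_lt_compat; auto. }
apply Rmult_le_compat_r; [left; apply Rinv_0_lt_compat; auto|].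
apply Rabs_le; apply Rabs_le_between in H1; apply Rabs_le_between in H2; lra.
Qed.

Lemma rotation_number_exists : exists L, rotation_number_is F L.
Proof.
assert (Cau : Cauchy_crit (fun n => (Nat.iter n F 0 - 0) / INR n)).
{ intros eps Heps.
  destruct (archimed_cor1 (eps / 2)) as (N & HN1 & HN2); [lra|].
  assert (HNp : 0 < INR N) by (apply lt_0_INR; auto).
  assert (Hi : forall n, (n >= N)%nat -> / INR n <= / INR N).
  { intros n Hn; apply Rinv_le_contravar; auto; apply le_INR; lia. }
  exists N; intros [|n] [|m] Hn Hm; try lia.
  unfold Rdist; eapply Rle_lt_trans; [apply iter_mean_dist|].
  generalize (Hi _ Hn) (Hi _ Hm); lra. }
destruct (Rcomplete.R_complete _ Cau) as (L & HL); exists L; intros x eps Heps.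
destruct (HL (eps / 2)) as (N1 & H1); [lra|].
destruct (archimed_cor1 (eps / 2)) as (N2 & HN2 & HN2'); [lra|].
exists (N1 + N2)%nat; intros n Hn.
specialize (H1 n ltac:(lia)).
assert (Hn0 : 0 < INR n) by (apply lt_0_INR; lia).
assert (Hi : / INR n <= / INR N2).
{ apply Rinv_le_contravar; [apply lt_0_INR; auto|apply le_INR; lia]. }
generalize (iter_displacement n x 0); intros H2.
unfold Rdist in *.
set (X := Nat.iter n F x - x) in *; set (Y := Nat.iter n F 0 - 0) in *.
assert (H3 : Rabs (X / INR n - Y / INR n) <= / INR n).
{ replace (X / INR n - Y / INR n) with ((X - Y) / INR n) by (field; lra).
  unfold Rdiv; rewrite Rabs_mult, (Rabs_right (/ INR n)).
  2:{ apply Rle_ge; left; apply Rinv_0_lt_compat; auto. }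
  rewrite <- (Rmult_1_l (/ INR n)) at 2; apply Rmult_le_compat_r; auto.
  left; apply Rinv_0_lt_compat; auto. }
apply Rabs_def2 in H1; apply Rabs_le_between in H3; apply Rabs_def1; lra.
Qed.

Lemma rotation_number_ge q p L :
  (0 < q)%nat -> (forall x, Nat.iter q F x >= x + p) ->
  rotation_number_is F L -> L >= p / INR q.
Proof.
intros Hq Hp HL.
assert (Hq0 : 0 < INR q) by (apply lt_0_INR; auto).
assert (Hit : forall n, Nat.iter (n * q) F 0 >= INR n * p).
{ induction n; [simpl; lra|].
  rewrite S_INR; simpl (S n * q)%nat; rewrite Nat.iter_add.
  generalize (Hp (Nat.iter (n * q) F 0)); lra. }
destruct (Rge_or_gt L (p / INR q)) as [H|H]; auto; exfalso.
destruct (HL 0 (p / INR q - L)) as (N & HN); [lra|].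
specialize (HN (S N * q)%nat ltac:(nia)); unfold Rdist in HN.
apply Rabs_def2 in HN; rewrite mult_INR in HN.
assert (HS : 0 < INR (S N)) by (apply lt_0_INR; lia).
assert (Hge : (Nat.iter (S N * q) F 0 - 0) / (INR (S N) * INR q) >= p / INR q).
{ replace (p / INR q) with ((INR (S N) * p) / (INR (S N) * INR q)) by (field; lra).
  apply Rle_ge, Rmult_le_compat_r.
  - left; apply Rinv_0_lt_compat, Rmult_lt_0_compat; auto.
  - generalize (Hit (S N)); lra. }
lra.
Qed.

Lemma iter_continuity n : continuity F -> continuity (Nat.iter n F).
Proof.
intros HF; induction n; simpl.
- apply derivable_continuous, derivable_id.
- exact (continuity_comp (Nat.iter n F) F IHn HF).
Qed.

(** The displacement of the [q]-th iterate is continuous and 1-periodic, so it attains a minimum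
    [p']. This exceeds [p], which keeps the inequality strict in the limit. *)
Lemma rotation_number_gt q p :
  (0 < q)%nat -> continuity F -> (forall x, Nat.iter q F x > x + p) ->
  exists L, L > p / INR q /\ rotation_number_is F L.
Proof.
intros Hq HF Hp.
destruct (continuity_ab_min (fun x => Nat.iter q F x - x) 0 1) as (m & Hm & _); [lra| |].
{ intros c _; apply continuity_minus.
  - apply iter_continuity; auto.
  - apply derivable_continuous, derivable_id. }
set (p' := Nat.iter q F m - m) in *.
destruct rotation_number_exists as (L & HL); exists L; split; auto.
assert (Hge : L >= p' / INR q).
{ apply rotation_number_ge; auto; intros x.
  destruct (archimed x) as [H1 H2].
  specialize (Hm (x + IZR (1 - up x))); rewrite iter_add_IZR, minus_IZR in Hm; lra. }
assert (p / INR q < p' / INR q).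
{ apply Rmult_lt_compat_r; [apply Rinv_0_lt_compat, lt_0_INR; auto|].
  unfold p'; generalize (Hp m); lra. }
lra.
Qed.

End Rotation.

(** * Words of point reflections *)

(* [Mat a b c d] is the matrix [[a, b], [c, d]]. *)
Inductive mat := Mat (a b c d : R).

Definition mapp (M : mat) (v : pt) : pt :=
  let (a, b, c, d) := M in (a * fst v + b * snd v, c * fst v + d * snd v).

Definition mmul (M N : mat) : mat :=
  let (a, b, c, d) := M in let (e, f, g, h) := N in
  Mat (a * e + b * g) (a * f + b * h) (c * e + d * g) (c * f + d * h).

Definition mdet (M : mat) : R := let (a, b, c, d) := M in a * d - b * c.
Definition mtr (M : mat) : R := let (a, b, c, d) := M in a + d.

(** The symmetric matrix of [chord_form V] followed by a quarter turn: it sends [uvec x] to a vector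
    whose form with [uvec x] vanishes. *)
Definition hmat (V : pt) : mat :=
  Mat (snd V) (- (1 + fst V)) (1 - fst V) (- snd V).

Lemma mapp_mmul (M N : mat) (v : pt) : mapp (mmul M N) v = mapp M (mapp N v).
Proof. destruct M, N, v; simpl; f_equal; ring. Qed.

Lemma mapp_pscal (M : mat) (k : R) (v : pt) : mapp M (pscal k v) = pscal k (mapp M v).
Proof. destruct M, v; unfold pscal; simpl; f_equal; ring. Qed.

Lemma pscal_pscal (k l : R) (v : pt) : pscal k (pscal l v) = pscal (k * l) v.
Proof. unfold pscal; simpl; f_equal; ring. Qed.

Lemma mdet_mmul (M N : mat) : mdet (mmul M N) = mdet M * mdet N.
Proof. destruct M, N; simpl; ring. Qed.

(** Cayley-Hamilton for [A], multiplied by [M] and traced. *)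
Lemma mtr_mul_sqr (M A : mat) :
  mtr (mmul M (mmul A A)) = mtr A * mtr (mmul M A) - mdet A * mtr M.
Proof. destruct M, A; simpl; ring. Qed.

Lemma mmul_assoc (M N K : mat) : mmul M (mmul N K) = mmul (mmul M N) K.
Proof. destruct M, N, K; simpl; f_equal; ring. Qed.

Lemma eigenvector_discr (M : mat) (v : pt) (k : R) :
  0 < dot v v -> mapp M v = pscal k v -> 4 * mdet M <= mtr M * mtr M.
Proof.
destruct M as [a b c d], v as [x y]; unfold dot, pscal; simpl; intros Hv E.
injection E; intros E2 E1.
assert (Hk : (k * k - (a + d) * k + (a * d - b * c)) * (x * x + y * y) = 0).
{ replace (k * k - (a + d) * k + (a * d - b * c))
    with ((a - k) * (d - k) - b * c) by ring.
  assert (H1 : (a - k) * x = - b * y) by lra.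
  assert (H2 : (d - k) * y = - c * x) by lra.
  assert (H3 : ((a - k) * (d - k) - b * c) * x = 0).
  { replace (((a - k) * (d - k) - b * c) * x)
      with ((d - k) * ((a - k) * x) - b * c * x) by ring.
    rewrite H1; replace ((d - k) * (- b * y)) with (- b * ((d - k) * y)) by ring.
    rewrite H2; ring. }
  assert (H4 : ((a - k) * (d - k) - b * c) * y = 0).
  { replace (((a - k) * (d - k) - b * c) * y)
      with ((a - k) * ((d - k) * y) - b * c * y) by ring.
    rewrite H2; replace ((a - k) * (- c * x)) with (- c * ((a - k) * x)) by ring.
    rewrite H1; ring. }
  rewrite Rmult_plus_distr_l, <- !Rmult_assoc, H3, H4; ring. }
apply Rmult_integral in Hk; destruct Hk as [Hk|Hk]; [|lra].
generalize (Rle_0_sqr (2 * k - (a + d))); unfold Rsqr; lra.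
Qed.

Lemma hturn_mapp (V : pt) (x : R) :
  inD V ->
  exists k, mapp (hmat V) (uvec x) = pscal k (uvec (hturn V x)).
Proof.
intros HV; destruct (chord_form_hturn V x HV) as (k & Hk & Ek); exists k.
(* [uvec 0] and [uvec (/ 2)] form the standard basis, so these two values of [y] give the two
   coordinates. *)
generalize (Ek 0) (Ek (/ 2)).
unfold chord_form, hmat, dot, pscal, uvec; simpl.
rewrite Rmult_0_r, cos_0, sin_0, Rminus_0_r.
change (PI * / 2) with (PI / 2); rewrite cos_PI2, sin_PI2.
replace (PI * (hturn V x - / 2)) with (- (PI / 2 - PI * hturn V x)) by field.
rewrite sin_neg, sin_shift; intros E1 E2; f_equal; lra.
Qed.

Definition wturn (w : list pt) (x : R) : R := fold_right hturn x w.
Definition wmat (w : list pt) : mat :=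
  fold_right (fun V => mmul (hmat V)) (Mat 1 0 0 1) w.

Lemma wturn_mapp (w : list pt) (x : R) :
  List.Forall inD w ->
  exists k, mapp (wmat w) (uvec x) = pscal k (uvec (wturn w x)).
Proof.
induction 1 as [|V w HV _ (k & IH)].
- exists 1; unfold pscal; simpl; f_equal; ring.
- destruct (hturn_mapp V (wturn w x) HV) as (l & Hl).
  exists (k * l); change (wmat (V :: w)) with (mmul (hmat V) (wmat w)).
  rewrite mapp_mmul, IH, mapp_pscal, Hl; apply pscal_pscal.
Qed.

Lemma wturn_continuity (w : list pt) : List.Forall inD w -> continuity (wturn w).
Proof.
induction 1 as [|V w HV _ IH].
- apply derivable_continuous, derivable_id.
- exact (continuity_comp (wturn w) (hturn V) IH (hturn_continuity V HV)).
Qed.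

Lemma uvec_add_INR (x : R) (n : nat) : exists k, uvec (x + INR n) = pscal k (uvec x).
Proof.
induction n as [|n (k & IH)].
- exists 1; simpl; rewrite Rplus_0_r; unfold pscal, uvec; simpl; f_equal; ring.
- exists (-1 * k); rewrite S_INR, <- Rplus_assoc, uvec_add1, IH; apply pscal_pscal.
Qed.

Definition advances (f : R -> R) (n : nat) : Prop := forall x, x + INR n < f x.

Lemma wturn_advances (w : list pt) (n : nat) (z : R) :
  List.Forall inD w -> mtr (wmat w) * mtr (wmat w) < 4 * mdet (wmat w) ->
  z + INR n < wturn w z -> advances (wturn w) n.
Proof.
intros Hw Hell Hz x.
destruct (Rle_or_lt (wturn w x) (x + INR n)) as [H|H]; auto; exfalso.
assert (Hfix : exists t, wturn w t = t + INR n).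
{ assert (Hc : continuity (fun t => wturn w t - (t + INR n))).
  { apply continuity_minus; [apply wturn_continuity; auto|].
    apply continuity_plus; [apply derivable_continuous, derivable_id|].
    apply continuity_const; intros a b; auto. }
  destruct (Rle_or_lt x z) as [Hxz|Hxz].
  - destruct (IVT_cor _ x z Hc Hxz) as (t & _ & Ht); [nra|exists t; lra].
  - destruct (IVT_cor _ z x Hc) as (t & _ & Ht); [lra|nra|exists t; lra]. }
destruct Hfix as (t & Ht).
destruct (wturn_mapp w t Hw) as (k & Hk).
destruct (uvec_add_INR t n) as (l & Hl).
rewrite Ht, Hl, pscal_pscal in Hk.
apply eigenvector_discr in Hk; [lra|].
generalize (uvec_norm t); unfold dot, uvec; simpl; lra.
Qed.

(* Conjugation by [hturn V] preserves the order and commutes with integer translations. *)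
Lemma advances_rotate (V : pt) (g : R -> R) (n : nat) :
  inD V -> advances (fun x => hturn V (g x)) n -> advances (fun x => g (hturn V x)) n.
Proof.
intros HV H x; specialize (H (hturn V x)); simpl in H.
assert (E : forall m, hturn V (x + INR m) = hturn V x + INR m).
{ induction m; [simpl; now rewrite !Rplus_0_r|].
  rewrite S_INR, <- !Rplus_assoc, hturn_add1, IHm; ring. }
rewrite <- E in H.
destruct (Rle_or_lt (g (hturn V x)) (x + INR n)) as [[H'|H']|H']; auto; exfalso.
- apply (hturn_incr V) in H'; auto; lra.
- rewrite H' in H; lra.
Qed.

(* [2 cosh d(U,V) sinh d(U,V) sinh delta(U,V,W) < 1], squared. *)
Definition small_triple (U V W : pt) : Prop :=
  4 * (kform U V * kform U V) * (cross (psub V U) (psub W U) * cross (psub V U) (psub W U))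
  < kgap U * kgap U * (kgap V * kgap V) * kgap W.

Lemma kgap_pos (V : pt) : inD V -> 0 < kgap V.
Proof. unfold kgap, inD; lra. Qed.

(** The reversed Cauchy-Schwarz inequality, that is [cosh d(U,V) >= 1]: [kform U V] is at least the
    arithmetic mean of the gaps, hence at least their geometric mean. *)
Lemma kform_ge (U V : pt) :
  inD U -> inD V -> kgap U * kgap V <= kform U V * kform U V.
Proof.
unfold inD, kgap, kform, dot; destruct U as [a b], V as [p q]; simpl; intros HU HV.
generalize (Rle_0_sqr (a - p)) (Rle_0_sqr (b - q)); unfold Rsqr; intros.
assert (H1 : (1 - (a * p + b * q)) * 2 >= (1 - (a * a + b * b)) + (1 - (p * p + q * q))) by lra.
set (A := 1 - (a * a + b * b)) in *; set (B := 1 - (p * p + q * q)) in *.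
assert (0 < A) by (unfold A; lra); assert (0 < B) by (unfold B; lra).
generalize (Rle_0_sqr (A - B)); unfold Rsqr; nra.
Qed.

Lemma mdet_hmat (V : pt) : mdet (hmat V) = kgap V.
Proof. unfold kgap, dot; simpl; ring. Qed.

Lemma mtr_hmat2 (U V : pt) : mtr (mmul (hmat U) (hmat V)) = - 2 * kform U V.
Proof. unfold kform, dot; simpl; ring. Qed.

Lemma mtr_hmat3 (U V W : pt) :
  mtr (mmul (hmat W) (mmul (hmat U) (hmat V))) = 2 * cross (psub V U) (psub W U).
Proof. unfold cross, psub; simpl; ring. Qed.

Lemma mmul_1_r (M : mat) : mmul M (Mat 1 0 0 1) = M.
Proof. destruct M; simpl; f_equal; ring. Qed.

(** The discriminant condition reads [N < 1], which follows from [small_triple] because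
    [cosh d(U,V) >= 1]. *)
Lemma advances_triple (U V W : pt) :
  inD U -> inD V -> inD W -> small_triple U V W ->
  advances (wturn (W :: U :: V :: nil)) 1.
Proof.
intros HU HV HW HS.
destruct (hturn_agree U V HU HV) as (z & Hz).
apply (wturn_advances _ _ z).
- repeat constructor; auto.
- unfold wmat; cbn [fold_right]; rewrite mmul_1_r, mtr_hmat3, !mdet_mmul, !mdet_hmat.
  generalize (kgap_pos U HU) (kgap_pos V HV) (kgap_pos W HW) (kform_ge U V HU HV).
  unfold small_triple in HS; revert HS.
  generalize (cross (psub V U) (psub W U)); intros c HS gU gV gW HB.
  generalize (Rle_0_sqr c); unfold Rsqr; intros Hc.
  set (D := kgap U * kgap V) in *.
  assert (HD : 0 < D) by (apply Rmult_lt_0_compat; auto).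
  assert (H1 : 4 * D * (c * c) <= 4 * (kform U V * kform U V) * (c * c)) by nra.
  assert (H2 : D * (4 * (c * c)) < D * (D * kgap W)) by (unfold D in *; nra).
  apply Rmult_lt_reg_l in H2; auto; unfold D in *; nra.
- simpl; rewrite <- Hz, hturn_hturn; auto.
  generalize (hturn_bounds W (z + 1)); lra.
Qed.

(** As [hmat W] has trace zero, [mtr_mul_sqr] leaves a product of two known traces, and the
    discriminant condition becomes exactly [small_triple]. *)
Lemma advances_quintuple (U V W : pt) :
  inD U -> inD V -> inD W -> small_triple U V W ->
  advances (wturn (W :: U :: V :: U :: V :: nil)) 2.
Proof.
intros HU HV HW HS.
destruct (hturn_agree U V HU HV) as (z & Hz).
apply (wturn_advances _ _ z).
- repeat constructor; auto.
- unfold wmat; cbn [fold_right]; rewrite mmul_1_r.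
  rewrite (mmul_assoc (hmat U) (hmat V)), mtr_mul_sqr, mtr_hmat2, mtr_hmat3.
  rewrite !mdet_mmul, !mdet_hmat.
  replace (mtr (hmat W)) with 0 by (simpl; ring).
  unfold small_triple in HS; nra.
- simpl; rewrite <- Hz, hturn_hturn, hturn_add1, <- Hz, hturn_add1, hturn_hturn; auto.
  generalize (hturn_bounds W (z + 1 + 1)); lra.
Qed.

(** * Cyclic words in the three vertices *)

Inductive vertex := vP | vQ | vR.

Section Words.

Variable pos : vertex -> pt.
Hypothesis pos_inD : forall i, inD (pos i).
Hypothesis pos_small :
  forall i j k, i <> j -> j <> k -> i <> k -> small_triple (pos i) (pos j) (pos k).

Let h i := hturn (pos i).

Lemma vertex_dec (i j : vertex) : {i = j} + {i <> j}.
Proof. decide equality. Qed.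

Lemma advances_h3 i j k : advances (fun x => h i (h j (h k x))) 1.
Proof.
assert (Hjk : forall i j, advances (fun x => h i (h j (h j x))) 1).
{ intros i' j' x; unfold h; rewrite hturn_hturn, hturn_add1 by auto.
  generalize (hturn_bounds (pos i') x); simpl; lra. }
destruct (vertex_dec j k) as [<-|Nj]; auto.
destruct (vertex_dec i j) as [<-|Ni].
{ apply (advances_rotate (pos k) (fun x => h i (h i x)) 1); auto; apply Hjk. }
destruct (vertex_dec i k) as [<-|Nk].
{ apply (advances_rotate (pos i) (fun x => h i (h j x)) 1); auto.
  apply (advances_rotate (pos j) (fun x => h i (h i x)) 1); auto; apply Hjk. }
apply (advances_triple (pos j) (pos k) (pos i)); auto.
Qed.

(** A cyclic word without equal neighbours is a proper 3-colouring of the 5-cycle: one letter occurs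
    once, and the other two alternate on the remaining four places. *)
Lemma vertex_word_cases (a b c d e : vertex) :
  let alternates a b c d e := b = d /\ c = e /\ b <> c /\ c <> a /\ b <> a in
  (a = b \/ b = c \/ c = d \/ d = e \/ e = a) \/
  alternates a b c d e \/ alternates b c d e a \/ alternates c d e a b \/
  alternates d e a b c \/ alternates e a b c d.
Proof. destruct a, b, c, d, e; simpl; intuition congruence. Qed.

Lemma advances_h5 a b c d e : advances (fun x => h a (h b (h c (h d (h e x))))) 2.
Proof.
assert (Hrot : forall a b c d e,
  advances (fun x => h a (h b (h c (h d (h e x))))) 2 ->
  advances (fun x => h b (h c (h d (h e (h a x))))) 2).
{ intros a' b' c' d' e' H.
  apply (advances_rotate (pos a') (fun x => h b' (h c' (h d' (h e' x))))); auto. }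
assert (Heq : forall a b c d, advances (fun x => h a (h a (h b (h c (h d x))))) 2).
{ intros a' b' c' d' x; generalize (advances_h3 b' c' d' x).
  unfold h at 4 5; rewrite hturn_hturn by auto; simpl; lra. }
assert (Halt : forall a b c d e, b = d /\ c = e /\ b <> c /\ c <> a /\ b <> a ->
  advances (fun x => h a (h b (h c (h d (h e x))))) 2).
{ intros a' b' c' d' e' (<- & <- & N1 & N2 & N3).
  apply (advances_quintuple (pos b') (pos c') (pos a')); auto. }
destruct (vertex_word_cases a b c d e)
  as [[H|[H|[H|[H|H]]]]|[H|[H|[H|[H|H]]]]]; try subst; auto 10.
Qed.

End Words.

(** * The triangle *)

Lemma small_triple_perm (U V W : pt) : small_triple U V W -> small_triple V U W.
Proof.
unfold small_triple; intros H.
replace (kform V U) with (kform U V) by (unfold kform, dot; ring).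
replace (cross (psub U V) (psub W V)) with (- cross (psub V U) (psub W U))
  by (unfold cross, psub; simpl; ring).
lra.
Qed.

(** Since [sinh Delta_2 = 1 / sinh (2 d)], a point [S] of the line closer to [R0] than [Delta_2]
    gives [2 sinh d cosh d sinh d(R0,S) < 1], and [cross_line] bounds [sinh delta] by
    [sinh d(R0,S)]. *)
Lemma small_triple_base (P Q R0 : pt) :
  inD P -> inD Q -> inD R0 -> 0 < dK P Q ->
  Rbar_lt (deltaK P Q R0) (Finite (DeltaK 2 P Q)) -> small_triple P Q R0.
Proof.
intros HP HQ HR Hd Hdel.
(* Otherwise [DeltaK 2 P Q] would be a lower bound of these distances and could not exceed their
   infimum. *)
assert (HS : exists S, on_chord P Q S /\ dK R0 S < DeltaK 2 P Q).
{ apply Classical_Prop.NNPP; intros Hno.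
  apply (Rbar_lt_not_le _ _ Hdel).
  apply (proj2 (Glb_Rbar_correct (fun r => exists S, on_chord P Q S /\ r = dK R0 S))).
  intros r (S & HS & ->); simpl.
  apply Rnot_lt_le; intros Hlt; apply Hno; exists S; auto. }
destruct HS as (S & (HSD & t & HSt) & Hlt).
destruct (dK_exp P Q HP HQ) as [He1 He2]; cbv zeta in He2.
destruct (dK_exp R0 S HR HSD) as [Hf1 Hf2]; cbv zeta in Hf2.
apply exp_increasing in Hd; rewrite exp_0 in Hd.
unfold DeltaK in Hlt; replace (INR 2 * dK P Q) with (dK P Q + dK P Q) in Hlt by (simpl; ring).
rewrite exp_plus in Hlt.
apply exp_increasing in Hlt.
set (e := exp (dK P Q)) in *; set (f := exp (dK R0 S)) in *.
rewrite exp_ln in Hlt by (apply Rdiv_lt_0_compat; nra).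
generalize (kgap_pos P HP) (kgap_pos Q HQ) (kgap_pos R0 HR) (kgap_pos S HSD).
intros gP gQ gR gS.
generalize (cross_line P Q R0 t); rewrite <- HSt; cbv zeta; intros Hline.
unfold small_triple.
set (cc := cross (psub Q P) (psub R0 P) * cross (psub Q P) (psub R0 P)) in *.
set (X := kform P Q * kform P Q) in *.
set (Z := kform R0 S * kform R0 S) in *.
set (Y := kgap P * kgap Q) in *.
set (W := kgap R0 * kgap S) in *.
assert (HY : 0 < Y) by (apply Rmult_lt_0_compat; auto).
assert (HW : 0 < W) by (apply Rmult_lt_0_compat; auto).
assert (Hcc : kgap S * cc <= (Z - W) * (X - Y)).
{ rewrite Hline; generalize (Rle_0_sqr (kform S Q * kform R0 P - kform S P * kform R0 Q)).
  unfold Rsqr; lra. }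
assert (HXY : (e - / e) * (e - / e) * Y = 4 * (X - Y)).
{ replace ((e - / e) * (e - / e)) with ((e + / e) * (e + / e) - 4) by (field; lra); lra. }
assert (HZW : (f - / f) * (f - / f) * W = 4 * (Z - W)).
{ replace ((f - / f) * (f - / f)) with ((f + / f) * (f + / f) - 4) by (field; lra); lra. }
assert (He : 0 < e - / e).
{ assert (/ e < 1) by (rewrite <- Rinv_1; apply Rinv_lt_contravar; lra); lra. }
assert (Hf : 0 <= f - / f).
{ assert (/ f <= 1) by (rewrite <- Rinv_1; apply Rinv_le_contravar; lra); lra. }
(* [sinh (Delta_2) = 1 / sinh (2 d)], in the form [f - 1/f < 4 / (e^2 - 1/e^2)]. *)
assert (Hfe : (f - / f) * ((e + / e) * (e - / e)) < 4).
{ set (g := (e * e + 1) / (e * e - 1)) in *.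
  assert (Hg : (g - / g) * ((e + / e) * (e - / e)) = 4).
  { unfold g; field; nra. }
  assert (/ g < / f) by (apply Rinv_lt_contravar; nra).
  assert (He' : 0 < (e + / e) * (e - / e)).
  { apply Rmult_lt_0_compat; auto; assert (0 < / e) by (apply Rinv_0_lt_compat; lra); lra. }
  rewrite <- Hg; apply Rmult_lt_compat_r; auto; lra. }
assert (Hsq : (f - / f) * (f - / f) * ((e + / e) * (e + / e)) * ((e - / e) * (e - / e)) < 16).
{ set (u := (f - / f) * ((e + / e) * (e - / e))) in *.
  assert (0 <= u).
  { unfold u; apply Rmult_le_pos; auto.
    apply Rmult_le_pos; [|lra]; assert (0 < / e) by (apply Rinv_0_lt_compat; lra); lra. }
  replace (_ * _ * _ * _) with (u * u) by (unfold u; ring); nra. }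
assert (Hfin : 4 * (Z - W) * (4 * X) * (4 * (X - Y)) < 16 * (W * Y * Y)).
{ rewrite <- HXY, <- HZW, <- He2.
  replace (_ * _ * _) with
   ((f - / f) * (f - / f) * ((e + / e) * (e + / e)) * ((e - / e) * (e - / e)) * (W * Y * Y)) by ring.
  apply Rmult_lt_compat_r; auto; repeat apply Rmult_lt_0_compat; auto. }
assert (HX : 0 <= X) by (unfold X; nra).
apply (Rmult_lt_reg_l (kgap S)); auto.
apply Rle_lt_trans with (4 * X * ((Z - W) * (X - Y))).
- nra.
- unfold W, Y in *; nra.
Qed.

Lemma small_triple_side (P Q R0 : pt) :
  inD P -> inD Q -> inD R0 -> dK P R0 = dK Q R0 -> ln 3 < dK P Q ->
  small_triple P Q R0 -> small_triple P R0 Q /\ small_triple Q R0 P.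
Proof.
intros HP HQ HR Hiso Hd HS.
destruct (dK_exp P Q HP HQ) as [_ He]; cbv zeta in He.
destruct (dK_exp P R0 HP HR) as [_ Hf]; cbv zeta in Hf.
destruct (dK_exp Q R0 HQ HR) as [_ Hg]; cbv zeta in Hg.
rewrite <- Hiso in Hg.
apply exp_increasing in Hd; rewrite exp_ln in Hd by lra.
set (e := exp (dK P Q)) in *; set (f := exp (dK P R0)) in *.
assert (Hpos : forall U V, inD U -> inD V -> 0 < kform U V).
{ intros U V HU HV; unfold kform; enough (dot U V < 1) by lra.
  apply dot_lt_1; auto; unfold inD in HU; lra. }
generalize (Hpos P Q HP HQ) (Hpos P R0 HP HR) (Hpos Q R0 HQ HR); intros bPQ bPR bQR.
generalize (kgap_pos P HP) (kgap_pos Q HQ) (kgap_pos R0 HR); intros gP gQ gR.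
generalize (cross_gram P Q R0); intros Hgram.
unfold small_triple in *.
replace (cross (psub R0 P) (psub Q P)) with (- cross (psub Q P) (psub R0 P))
  by (unfold cross, psub; simpl; ring).
replace (cross (psub R0 Q) (psub P Q)) with (cross (psub Q P) (psub R0 P))
  by (unfold cross, psub; simpl; ring).
rewrite Rmult_opp_opp.
set (cc := cross (psub Q P) (psub R0 P) * cross (psub Q P) (psub R0 P)) in *.
(* With square roots of the gaps, each [kform] becomes a hyperbolic cosine times two of these
   roots. *)
assert (Hroot : forall g, 0 < g -> exists s, 0 < s /\ g = s * s).
{ intros g Hg0; exists (sqrt g); split; [apply sqrt_lt_R0; auto|symmetry; apply sqrt_sqrt; lra]. }
destruct (Hroot _ gP) as (p & Hp & Ep), (Hroot _ gQ) as (q & Hq & Eq),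
  (Hroot _ gR) as (r & Hr & Er).
rewrite Ep, Eq, Er in *.
(* [C = cosh d(P,Q)] and [b = cosh d(P,R) = cosh d(Q,R)]. *)
set (C := (e + / e) / 2); set (b := (f + / f) / 2).
assert (Hcosh : forall x, 0 < x -> 0 < x + / x).
{ intros x Hx; generalize (Rinv_0_lt_compat x Hx); lra. }
assert (Hf0 : 0 < f) by apply exp_pos.
generalize (Hcosh e ltac:(lra)) (Hcosh f Hf0); intros Ce Cf.
assert (HC0 : 0 < C) by (unfold C; lra).
assert (Hb0 : 0 < b) by (unfold b; lra).
assert (Ekform : forall B c s t, 0 < B -> 0 < c -> 0 < s -> 0 < t ->
  c * c * (s * s * (t * t)) = 4 * (B * B) -> B = c / 2 * (s * t)).
{ intros B c s t HB Hc Hs Ht E.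
  apply Rsqr_inj; [lra|repeat apply Rmult_le_pos; lra|unfold Rsqr; lra]. }
assert (EPQ : kform P Q = C * (p * q)) by (apply Ekform; auto).
assert (EPR : kform P R0 = b * (p * r)) by (apply Ekform; auto).
assert (EQR : kform Q R0 = b * (q * r)) by (apply Ekform; auto).
(* [5 / 3] is [cosh (ln 3)]. *)
assert (HC : 5 / 3 < C).
{ unfold C; apply (Rmult_lt_reg_l (6 * e)); [lra|].
  replace (6 * e * ((e + / e) / 2)) with (3 * (e * e + 1)) by (field; lra); nra. }
rewrite EPQ, EPR, EQR in *.
set (m := p * p * (q * q) * (r * r)).
assert (Hm : 0 < m) by (unfold m; repeat apply Rmult_lt_0_compat; auto).
assert (Ecc : cc = (C - 1) * (2 * (b * b) - C - 1) * m) by (rewrite Hgram; unfold m; ring).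
set (n := (C - 1) * (2 * (b * b) - C - 1)) in *.
assert (HS' : 4 * (C * C) * n < 1).
{ apply (Rmult_lt_reg_r (m * (p * p * (q * q)))); [repeat apply Rmult_lt_0_compat; auto|].
  rewrite Ecc in HS; unfold m in *; lra. }
assert (Hn : 0 <= n).
{ apply (Rmult_le_reg_r m); auto; rewrite Rmult_0_l, <- Ecc; unfold cc; nra. }
(* Here [n] is [N^2], and it grows with [b]. If [b > C], then [n] would be at least its value at
   [b = C], which exceeds 1 for [C > 5 / 3], against [4 C^2 n < 1]. *)
assert (HbC : b <= C).
{ apply Rnot_lt_le; intros Hlt.
  assert ((C - 1) * (2 * (C * C) - C - 1) <= n).
  { assert (C * C < b * b) by nra; unfold n; apply Rmult_le_compat_l; lra. }
  assert (1 < (C - 1) * (2 * (C * C) - C - 1)).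
  { assert (2 < 2 * (C * C) - C - 1) by nra; nra. }
  nra. }
rewrite Ecc.
assert (Hgoal : 4 * (b * b) * n < 1).
{ assert (b * b <= C * C) by (apply Rmult_le_compat; lra).
  assert (b * b * n <= C * C * n) by (apply Rmult_le_compat_r; auto); lra. }
split; [apply (Rmult_lt_compat_r (m * (p * p * (r * r)))) in Hgoal
       |apply (Rmult_lt_compat_r (m * (q * q * (r * r)))) in Hgoal];
  try (now repeat apply Rmult_lt_0_compat); unfold m in *; lra.
Qed.

(** * The lift as a minimum of vertex reflections *)

Section Triangle.

Variables (pos : vertex -> pt) (F : R -> R).
Hypothesis pos_inD : forall i, inD (pos i).
Hypothesis F_lift :
  is_normalized_lift_psi (filled_triangle (pos vP) (pos vQ) (pos vR)) F.

Lemma triangle_vertex i : filled_triangle (pos vP) (pos vQ) (pos vR) (pos i).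
Proof.
destruct i; [exists 1, 0, 0|exists 0, 1, 0|exists 0, 0, 1]; repeat split; try lra;
  unfold padd, pscal; simpl; [destruct (pos vP)|destruct (pos vQ)|destruct (pos vR)];
  simpl; f_equal; ring.
Qed.

(** The displacement [F x - x] is continuous, lies in [[0,1)] at 0, and never equals 0 or 1 because
    [psi_rel] excludes [w = v]. *)
Lemma lift_bounds x : x < F x < x + 1.
Proof.
destruct F_lift as (Fc & F0 & Fpsi).
assert (N0 : forall z, F z <> z).
{ intros z Hz; destruct (Fpsi z) as (_ & N & _); now rewrite Hz in N. }
assert (N1 : forall z, F z <> z + 1).
{ intros z Hz; destruct (Fpsi z) as (_ & N & _); now rewrite Hz, ecirc_add1 in N. }
assert (Cross : forall c, (F 0 - 0 - c) * (F x - x - c) <= 0 -> exists z, F z = z + c).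
{ intros c Hc.
  assert (Hcont : continuity (fun z => F z - z - c)).
  { apply continuity_minus; [apply continuity_minus; auto|].
    - apply derivable_continuous, derivable_id.
    - apply continuity_const; intros a b; auto. }
  destruct (Rle_or_lt 0 x) as [H|H].
  - destruct (IVT_cor _ 0 x Hcont H Hc) as (z & _ & Hz); exists z; lra.
  - destruct (IVT_cor _ x 0 Hcont) as (z & _ & Hz); [lra|lra|exists z; lra]. }
split; apply Rnot_le_lt; intros H.
- destruct (Cross 0) as (z & Hz); [nra|]; apply (N0 z); lra.
- destruct (Cross 1) as (z & Hz); [nra|]; apply (N1 z); lra.
Qed.

Lemma lift_le_hturn i x : F x <= hturn (pos i) x.
Proof.
apply chord_form_ge_0; auto; [apply lift_bounds|].
destruct F_lift as (_ & _ & Fpsi); destruct (Fpsi x) as (_ & _ & _ & Hl).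
specialize (Hl _ (triangle_vertex i)); rewrite cross_ecirc in Hl.
generalize (lift_bounds x); intros Hb.
generalize (sin_PI_pos (F x - x) ltac:(lra)); intros Hs; nra.
Qed.

(** The line meets the triangle in a convex combination of vertices, none of which is to its right;
    a vertex of nonzero weight must therefore lie on the line. *)
Lemma lift_hturn x : exists i, F x = hturn (pos i) x.
Proof.
destruct F_lift as (_ & _ & Fpsi); destruct (Fpsi x) as (_ & _ & (y & Hy & Hy0) & Hl).
generalize (lift_bounds x); intros Hb.
generalize (sin_PI_pos (F x - x) ltac:(lra)); intros Hs.
assert (Hv : exists i, cross (psub (ecirc (F x)) (ecirc x)) (psub (pos i) (ecirc x)) = 0).
{ destruct Hy as (a & b & c & Ha & Hb' & Hc & Hsum & ->).
  assert (Haff : a * cross (psub (ecirc (F x)) (ecirc x)) (psub (pos vP) (ecirc x))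
    + b * cross (psub (ecirc (F x)) (ecirc x)) (psub (pos vQ) (ecirc x))
    + c * cross (psub (ecirc (F x)) (ecirc x)) (psub (pos vR) (ecirc x)) = 0).
  { rewrite <- Hy0; replace a with (1 - b - c) by lra.
    unfold cross, psub, padd, pscal; simpl; ring. }
  generalize (Hl _ (triangle_vertex vP)) (Hl _ (triangle_vertex vQ))
    (Hl _ (triangle_vertex vR)); intros LP LQ LR.
  set (kP := cross _ (psub (pos vP) _)) in *.
  set (kQ := cross _ (psub (pos vQ) _)) in *.
  set (kR := cross _ (psub (pos vR) _)) in *.
  destruct (Req_dec a 0) as [Ea|Ea]; [destruct (Req_dec b 0) as [Eb|Eb]|].
  - exists vR; fold kR; nra.
  - exists vQ; fold kQ; nra.
  - exists vP; fold kP; nra. }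
destruct Hv as (i & Hi); exists i; apply chord_form_eq_0; auto.
rewrite cross_ecirc in Hi; nra.
Qed.

Lemma lift_mono x y : x <= y -> F x <= F y.
Proof.
intros [H|<-]; [|lra].
destruct (lift_hturn y) as (i & ->).
generalize (lift_le_hturn i x) (hturn_incr (pos i) x y (pos_inD i) H); lra.
Qed.

Lemma lift_add1 x : F (x + 1) = F x + 1.
Proof.
destruct (lift_hturn x) as (i & Hi), (lift_hturn (x + 1)) as (j & Hj).
generalize (lift_le_hturn i (x + 1)) (lift_le_hturn j x).
rewrite Hi, Hj, !hturn_add1; lra.
Qed.

End Triangle.

Theorem theorem6p1 (P Q R0 : pt) (F : R -> R) :
  inD P -> inD Q -> inD R0 ->
  dK P R0 = dK Q R0 ->
  dK P Q > ln 3 ->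
  Rbar_lt (deltaK P Q R0) (Finite (DeltaK 2 P Q)) ->
  is_normalized_lift_psi (filled_triangle P Q R0) F ->
  exists L, L > 2 / 5 /\ rotation_number_is F L.
Proof.
intros HP HQ HR Hiso Hd Hdel HF.
pose (pos := fun i => match i with vP => P | vQ => Q | vR => R0 end).
assert (Hin : forall i, inD (pos i)) by (intros []; auto).
assert (Hln3 : 0 < ln 3) by (rewrite <- ln_1; apply ln_increasing; lra).
assert (S1 : small_triple P Q R0) by (apply small_triple_base; auto; lra).
assert (S1' := small_triple_perm _ _ _ S1).
destruct (small_triple_side P Q R0) as [S2 S3]; auto.
(* The six orderings are [S1], [S2], [S3] and their swaps of the first two points. *)
assert (Hsmall : forall i j k, i <> j -> j <> k -> i <> k ->
  small_triple (pos i) (pos j) (pos k)).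
{ intros [] [] [] H1 H2 H3; try congruence; simpl; auto using small_triple_perm. }
replace (2 / 5) with (2 / INR 5) by (simpl; field).
apply rotation_number_gt; try lia.
- exact (lift_mono pos F Hin HF).
- exact (lift_add1 pos F Hin HF).
- apply HF.
- intros x; simpl.
  destruct (lift_hturn pos F Hin HF x) as (i1 & ->).
  destruct (lift_hturn pos F Hin HF (hturn (pos i1) x)) as (i2 & ->).
  destruct (lift_hturn pos F Hin HF (hturn (pos i2) (hturn (pos i1) x))) as (i3 & ->).
  destruct (lift_hturn pos F Hin HF
    (hturn (pos i3) (hturn (pos i2) (hturn (pos i1) x)))) as (i4 & ->).
  destruct (lift_hturn pos F Hin HF
    (hturn (pos i4) (hturn (pos i3) (hturn (pos i2) (hturn (pos i1) x))))) as (i5 & ->).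
  generalize (advances_h5 pos Hin Hsmall i5 i4 i3 i2 i1 x); simpl; lra.
Qed.
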